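(* Let $F_1,\dots,F_k\in\mathcal{F}_{\bar t,B,\bar m_2,\kappa}$. Let $\varepsilon\in\left(0,\min\left(\tfrac{2\bar t}{1+2\bar t},\tfrac1B\right)\right)$ and $\bar U:=B\,\bar m_2\,\tfrac{\varepsilon}{2(1-\varepsilon)}$ if the adversary is oblivious or prescient, or let $\varepsilon\in\left(0,\min\left(\bar t,\tfrac1B\right)\right)$ and $\bar U:=B\,\bar m_2\,\varepsilon$ if the adversary is malicious. Let $\alpha>0$, $\delta\in(0,1)$, and consider running the uniform exploration algorithm with parameters $(\alpha,\delta)$ (described in the context) for Contaminated Best Arm Identification. Let $\hat I$ denote the arm it outputs, let $Y$ be a random variable whose conditional distribution given $\hat I$ is $F_{\hat I}$, and let $\hat m_1$ and $\hat m_2$ denote the empirical median and empirical median absolute deviation, respectively, of the samples the algorithm has seen from arm $\hat I$. Then, simultaneously for all $t\in[0,\bar t]$, $$\mathbb{P}\Big(Y\ge\left(\hat m_1-tB\hat m_2\right)-\left(\left(\tfrac12+2\kappa tB\right)\alpha+\left(1+(1+2\kappa)Bt\right)\bar U\right)\Big)\ge\tfrac12+t-\tfrac{3\delta}{k}.$$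
   Context: Notation. Distributions are on $\mathbb{R}$ and identified with cdfs. $Q_{L,F}(p)=\inf\{x:F(x)\ge p\}$, $Q_{R,F}(p)=\inf\{x:F(x)>p\}$. For $X\sim F$: $m_1(F)$ is the median of $F$ (when unique), $m_2(F)$ is the median of $|X-m_1(F)|$ (median absolute deviation, MAD), and $m_4(F)$ is the median of $\big||X-m_1(F)|-m_2(F)\big|$. The empirical median of $x_1,\dots,x_n$ is the middle value if $n$ is odd and the average of the two middle values if $n$ is even; the empirical MAD is the empirical median of $|x_1-\hat m|,\dots,|x_n-\hat m|$, with $\hat m$ the empirical median of $x_1,\dots,x_n$. For $\bar t\in(0,\tfrac12)$, $B>0$, $\bar m_2>0$, $\kappa\ge0$, $\mathcal{F}_{\bar t,B,\bar m_2,\kappa}$ is the family of distributions $F$ with unique $m_1(F),m_2(F),m_4(F)$ such that: (i) $|F(x_1)-F(x_2)|\ge\frac{1}{B\,m_2(F)}|x_1-x_2|$ for all $x_1,x_2\in[Q_{L,F}(\tfrac12-\bar t),Q_{R,F}(\tfrac12+\bar t)]\cup[m_1(F)-2m_2(F),m_1(F)+2m_2(F)]$; (ii) $m_2(F)\le\bar m_2$; (iii) $m_2(F)\le\kappa\,m_4(F)$. Contaminated Best Arm Identification (CBAI). There are $k\ge2$ arms with unknown true distributions $F_1,\dots,F_k$ and contamination level $\varepsilon\in(0,\tfrac12)$. At each iteration $t$ an algorithm picks an arm $I_t\in[k]$ and observes $X_{I_t,t}$, where $X_{i,t}=(1-D_{i,t})Y_{i,t}+D_{i,t}Z_{i,t}$,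 $Y_{i,t}\sim F_i$, $D_{i,t}\sim\mathrm{Ber}(\varepsilon)$, and $Z_{i,t}$ is an arbitrary contamination. Adversaries: - Oblivious: for each $i$ the triples $(Y_{i,t},D_{i,t},Z_{i,t})_{t\ge1}$ are independent across $t$; $Y_{i,t}$ and $D_{i,t}$ are independent. - Prescient: for each $i$ the pairs $(Y_{i,t},D_{i,t})_{t\ge1}$ are independent across $t$, $Y_{i,t}$ and $D_{i,t}$ are independent, and each $Z_{i,t}$ may depend on all of $\{Y_{j,s},D_{j,s},Z_{j,s}\}_{j\in[k],s\ge1}$. - Malicious: as prescient, but $Y_{i,t}$ and $D_{i,t}$ need not be independent of each other. Uniform exploration algorithm with parameters $(\alpha,\delta)$: sample each arm $i\in[k]$ $n_{\alpha/2,\delta/k}$ times (rounded up), let $\hat p_i$ be the empirical median of the observed samples of arm $i$, and output $\hat I\in\arg\max_i\hat p_i$. Here $n_{\alpha/2,\delta/k}=2\max\left(\tfrac{4B^2\bar m_2^2}{\alpha^2},\left(\bar t-\tfrac{\varepsilon}{2(1-\varepsilon)}\right)^{-2}\right)\log\tfrac{2k}{\delta}$ for oblivious and prescient adversaries, and $n_{\alpha/2,\delta/k}=2\max\left(\tfrac{4B^2\bar m_2^2}{\alpha^2},(\bar t-\varepsilon)^{-2}\right)\log\tfrac{3k}{\delta}$ for malicious adversaries. *)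

(* Defs.v *)
From HB Require Import structures.
From mathcomp Require Import all_boot all_order all_algebra.
From mathcomp Require Import all_classical all_reals all_analysis.
From mathcomp Require Import measurable_realfun.

Set Implicit Arguments.
Unset Strict Implicit.
Unset Printing Implicit Defensive.

Import Order.TTheory GRing.Theory Num.Theory.
Import numFieldNormedType.Exports.

Local Open Scope classical_set_scope.
Local Open Scope ring_scope.

Notation realDistr R := (probability (measurableTypeR R) R).

Section quantiles.
Context {R : realType}.
Implicit Types (F : realDistr R) (p a : R).

Definition idR : measurableTypeR R -> R := idfun.
HB.instance Definition _ :=
  @isMeasurableFun.Build _ _ _ _ idR (@measurable_id _ _ setT).

Definition dist_to a : measurableTypeR R -> measurableTypeR R :=
  fun x => `|x - a|.
Lemma measurable_dist_to a : measurable_fun setT (dist_to a).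
Proof.
apply: measurableT_comp (@normr_measurable R setT) _.
exact: measurable_funB.
Qed.
HB.instance Definition _ a :=
  @isMeasurableFun.Build _ _ _ _ (dist_to a) (measurable_dist_to a).

Definition cdfR F (x : R) : R := fine (cdf (idR : {RV F >-> R}) x).

(* These are real-valued infima, meaningful for 0 < p < 1 only. *)
Definition QL F p : R := inf [set x : R | p <= cdfR F x].
Definition QR F p : R := inf [set x : R | p < cdfR F x].

(* The set of medians of F is `[QL F 2^-1, QR F 2^-1]; [median F] is the median
   of F whenever [unique_median F] holds. *)
Definition unique_median F : Prop := QL F 2^-1 = QR F 2^-1.
Definition median F : R := QL F 2^-1.

(* Law of |X - a| when X has law F. *)
Definition absdev F a : realDistr R :=
  distribution F (dist_to a : {RV F >-> measurableTypeR R}).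

Definition m1 F : R := median F.
Definition m2 F : R := median (absdev F (m1 F)).
Definition m4 F : R := median (absdev (absdev F (m1 F)) (m2 F)).

(* The condition 0 < m2 F is implicit in the division by B * m2 F; it has to be
   explicit here, since x / 0 = 0. *)
Definition in_family (tbar B m2bar kappa : R) F : Prop :=
  [/\ [/\ unique_median F, unique_median (absdev F (m1 F))
         & unique_median (absdev (absdev F (m1 F)) (m2 F))],
      0 < m2 F,
      (let S := `[QL F (2^-1 - tbar), QR F (2^-1 + tbar)] `|`
                `[m1 F - 2 * m2 F, m1 F + 2 * m2 F] in
       forall x1 x2 : R, S x1 -> S x2 ->
         (B * m2 F)^-1 * `|x1 - x2| <= `|cdfR F x1 - cdfR F x2|),
      m2 F <= m2bar
    & m2 F <= kappa * m4 F].

End quantiles.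

Section empirical.
Context {R : realType}.
Implicit Types s : seq R.

Definition emp_median s : R :=
  let u := sort <=%R s in let n := size s in
  if odd n then u`_(n./2) else (u`_(n./2.-1) + u`_(n./2)) / 2.

Definition emp_mad s : R := emp_median [seq `|x - emp_median s| | x <- s].

End empirical.

Section independence.
Context {R : realType} {d} {T : measurableType d} (P : probability T R).

Definition independent_seq {d'} {T' : measurableType d'}
    (X : nat -> T -> T') : Prop :=
  forall (J : seq nat) (A : nat -> set T'), uniq J ->
    (forall t, measurable (A t)) ->
    P (\bigcap_(t in [set` J]) X t @^-1` A t) =
    (\prod_(t <- J) P (X t @^-1` A t))%E.

Definition independent_pair {d1 d2} {T1 : measurableType d1}
    {T2 : measurableType d2} (X : T -> T1) (Y : T -> T2) : Prop :=
  forall (A : set T1) (B : set T2), measurable A -> measurable B ->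
    P (X @^-1` A `&` Y @^-1` B) = (P (X @^-1` A) * P (Y @^-1` B))%E.

End independence.

Inductive adversary := Oblivious | Prescient | Malicious.

Section cbai.
Context {R : realType} {d} {T : measurableType d} (P : probability T R).
Variable k : nat.
Variables (Y : 'I_k -> nat -> {RV P >-> R}) (D : 'I_k -> nat -> {RV P >-> bool})
  (Z : 'I_k -> nat -> {RV P >-> R}).

(* Under the prescient and malicious adversaries each Z i t is an arbitrary
   random variable: nothing is assumed about its joint law with the rest. *)
Definition contamination_model (adv : adversary) (eps : R)
    (F : 'I_k -> realDistr R) : Prop :=
  [/\ forall i t (A : set R), measurable A -> distribution P (Y i t) A = F i A,
      forall i t (b : set bool), distribution P (D i t) b = bernoulli_prob eps b
    & match adv with
      | Oblivious =>
          (forall i, independent_seq P (fun t w => (Y i t w, D i t w, Z i t w)))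
          /\ (forall i t, independent_pair P (Y i t) (D i t))
      | Prescient =>
          (forall i, independent_seq P (fun t w => (Y i t w, D i t w)))
          /\ (forall i t, independent_pair P (Y i t) (D i t))
      | Malicious =>
          forall i, independent_seq P (fun t w => (Y i t w, D i t w))
      end].

Definition observed (i : 'I_k) (t : nat) (w : T) : R :=
  (1 - (D i t w)%:R) * Y i t w + (D i t w)%:R * Z i t w.

(* [sched] lists the arms pulled at the successive iterations. *)
Definition samples (sched : seq 'I_k) (i : 'I_k) (w : T) : seq R :=
  [seq observed i t w | t <- iota 0 (size sched) & nth i sched t == i].

(* [Ihat] is any measurable selection of an arm with maximal empirical
   median; the order in which the arms are pulled is left unspecified. *)
Definition uniform_exploration (n : nat) (sched : seq 'I_k)
    (Ihat : T -> 'I_k) : Prop :=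
  [/\ forall i, count_mem i sched = n,
      forall i, measurable (Ihat @^-1` [set i])
    & forall w i, emp_median (samples sched i w)
                  <= emp_median (samples sched (Ihat w) w)].

End cbai.

Section parameters.
Context {R : realType}.
Implicit Types (adv : adversary) (tbar B m2bar eps alpha delta : R).

Definition eps_max adv tbar B : R :=
  if adv is Malicious then Num.min tbar B^-1
  else Num.min (2 * tbar / (1 + 2 * tbar)) B^-1.

Definition eff_contamination adv eps : R :=
  if adv is Malicious then eps else eps / (2 * (1 - eps)).

Definition Ubar adv B m2bar eps : R := B * m2bar * eff_contamination adv eps.

(* n_{alpha/2, delta/k}, before rounding up. *)
Definition budget adv tbar B m2bar eps (k : nat) alpha delta : R :=
  2 * Num.max (4 * B ^+ 2 * m2bar ^+ 2 / alpha ^+ 2)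
              ((tbar - eff_contamination adv eps) ^- 2)
    * ln ((if adv is Malicious then 3 else 2) * k%:R / delta).

Definition pulls adv tbar B m2bar eps (k : nat) alpha delta : nat :=
  `|Num.ceil (budget adv tbar B m2bar eps k alpha delta)|%N.

End parameters.

(* Main.v *)
Require Import Defs.
From HB Require Import structures.
From mathcomp Require Import all_boot all_order all_algebra.
From mathcomp Require Import all_classical all_reals all_analysis.
From mathcomp Require Import measurable_realfun.
From mathcomp Require Import ring lra zify.
Import Order.TTheory GRing.Theory Num.Theory.
Import numFieldNormedType.Exports.
Local Open Scope classical_set_scope.
Local Open Scope ring_scope.

(** Call a sample of an arm clean when it is uncontaminated. Assumption (i) makes
    the cdf of an arm grow at rate at least 1/(B m2) around its median and its
    MAD, so each of the half-lines y <= m1 + h and m1 - h <= y, and the set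
    |y - m1| >= m2 - h, has probability at least 1/2 + e + x with
    h = B m2 (e + x), where e is the effective contamination and x the tolerance.
    Hence a single pull is clean and falls in such a set with probability at
    least 1/2 + (3/4) x, as (i) on [m1 - 2 m2, m1 + 2 m2] forces B >= 4 and so
    eps < 1/4. When a strict majority of the samples does so, the contaminated
    values are irrelevant and the empirical median and MAD are off by at most h
    and (from below) 2h.

    By Chernoff's bound each such majority fails with probability at most
    exp(-2 n (3x/4)^2) <= (delta/(2k))^2 <= delta/k^2. The exponent exceeds the
    one announced by the sample size, and this is what pays for a union bound
    over all 3k failures, giving 3 delta/k although the selected arm is random. *)

(** * Real-valued probabilities: monotonicity, complements and finite unions *)

Section real_probability.
Context {R : realType} {d} {T : measurableType d} (P : probability T R).
Implicit Types A C : set T.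

Definition prob A : R := fine (P A).

Lemma probE A : measurable A -> P A = (prob A)%:E.
Proof. by move=> mA; rewrite /prob fineK// fin_num_measure. Qed.

Lemma prob_ge0 A : 0 <= prob A.
Proof. by rewrite fine_ge0. Qed.

Lemma probT : prob setT = 1.
Proof. by rewrite /prob probability_setT. Qed.

Lemma le_prob A C : measurable A -> measurable C -> A `<=` C ->
  prob A <= prob C.
Proof.
move=> mA mC AC; rewrite -lee_fin -!probE//.
by apply: le_measure => //; rewrite inE.
Qed.

Lemma prob_le1 A : measurable A -> prob A <= 1.
Proof. by move=> mA; rewrite -probT; apply: le_prob. Qed.

Lemma probU A C : measurable A -> measurable C -> A `&` C = set0 ->
  prob (A `|` C) = prob A + prob C.
Proof.
move=> mA mC AC; apply: EFin_inj; rewrite EFinD -!probE//; last exact: measurableU.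
by rewrite measureU.
Qed.

Lemma probC A : measurable A -> prob (~` A) = 1 - prob A.
Proof.
move=> mA; apply: (addIr (prob A)); rewrite subrK -probU ?setvU ?probT ?setICl//.
exact: measurableC.
Qed.

Lemma probU_le A C : measurable A -> measurable C ->
  prob (A `|` C) <= prob A + prob C.
Proof.
move=> mA mC; have mAC := measurableU _ _ mA mC.
rewrite -lee_fin EFinD -!probE//; exact: measureU2.
Qed.

Lemma prob_disjoint_sum (I : finType) (p : pred I) (A : I -> set T) :
  (forall i, measurable (A i)) ->
  (forall i j, i != j -> A i `&` A j = set0) ->
  prob (\bigcup_(i in [set` p]) A i) = \sum_(i | p i) prob (A i).
Proof.
move=> mA tA; apply: EFin_inj; rewrite -sumEFin -probE; last first.
  exact: fin_bigcup_measurable.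
rewrite measure_fin_bigcup//; last first.
  by apply/trivIsetP => i j _ _; exact: tA.
rewrite -(bigfs _ (index_enum_uniq I)).
  by apply: eq_bigr => i _; exact: probE.
by move=> i _; rewrite mem_index_enum.
Qed.

Lemma prob_union_le (I : finType) (A : I -> set T) (b : R) :
  (forall i, measurable (A i)) -> (forall i, prob (A i) <= b) ->
  prob (\bigcup_i A i) <= #|I|%:R * b.
Proof.
move=> mA Ab.
have mU : measurable (\bigcup_i A i).
  apply: fin_bigcup_measurable => //; exact: finite_finset.
rewrite -lee_fin -probE//.
have := content_sub_fsum P _ (fun i _ => mA i) mU (@subset_refl _ _).
move=> /(_ finite_finset)/le_trans; apply.
rewrite (_ : [set: I] = [set` xpredT]); last by apply/seteqP.
rewrite -(bigfs _ (index_enum_uniq I) (P := xpredT)); last first.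
  by move=> i _; rewrite mem_index_enum.
rewrite (eq_bigr (fun i => (prob (A i))%:E)) => [|i _]; last exact: probE.
rewrite sumEFin lee_fin; apply: (@le_trans _ _ (\sum_(i : I) b)).
  exact: ler_sum.
by rewrite sumr_const mulr_natl.
Qed.
End real_probability.

(** * Cdfs and their quantiles *)

Section quantile_lemmas.
Context {R : realType}.
Implicit Types (F : realDistr R) (p x y : R).

Lemma cdfR_prob F x : cdfR F x = prob F `]-oo, x].
Proof. by []. Qed.

Lemma measurable_rayNy (b : bool) x :
  measurable ([set` Interval -oo%O (BSide b x)] : set (measurableTypeR R)).
Proof. exact: measurable_itv. Qed.

Lemma le_cdfR F x y : x <= y -> cdfR F x <= cdfR F y.
Proof.
move=> xy; rewrite !cdfR_prob; apply: le_prob; try exact: measurable_itv.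
by move=> z /=; rewrite !in_itv/= => /le_trans; apply.
Qed.

Lemma prob_itvoc F x y : x <= y -> prob F `]x, y] = cdfR F y - cdfR F x.
Proof.
move=> xy; rewrite !cdfR_prob.
have -> : `]-oo, y]%classic = `]-oo, x]%classic `|` `]x, y]%classic.
  apply/seteqP; split => z /=; rewrite !in_itv/=.
    by move=> zy; case: (leP z x); [left | right].
  by case=> [zx|/andP[]//]; exact: le_trans xy.
rewrite probU; [ | exact: measurable_itv | exact: measurable_itv | ].
  by rewrite [RHS]addrC addrA addNr add0r.
apply/seteqP; split => z //=; rewrite !in_itv/= => -[zx /andP[xz _]].
by move: xz; rewrite ltNge zx.
Qed.

Lemma cvg_cdfRy F : cdfR F x @[x --> +oo] --> (1 : R).
Proof. by apply/fine_cvg; exact: cvg_cdfy1. Qed.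

Lemma cvg_cdfRNy F : cdfR F x @[x --> -oo] --> (0 : R).
Proof. by apply/fine_cvg; exact: cvg_cdfNy0. Qed.

Lemma cdfR_right_continuous F : right_continuous (cdfR F).
Proof.
move=> a; apply: fine_cvg.
by rewrite fineK ?fin_num_measure//; exact: cdf_right_continuous.
Qed.

Lemma cdfR_gt_nonempty F p : p < 1 -> [set x | p < cdfR F x] !=set0.
Proof.
move=> p1; have near_p : \forall x \near +oo, p < cdfR F x.
  exact: cvgr_gt (cvg_cdfRy F) _ p1.
by have [x] := filter_ex near_p; exists x.
Qed.

Lemma cdfR_ge_lbound F p : 0 < p -> has_lbound [set x | p <= cdfR F x].
Proof.
move=> p0; have near_p : \forall x \near -oo, cdfR F x < p.
  exact: cvgr_lt (cvg_cdfRNy F) _ p0.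
have [a aP] := filter_ex near_p.
exists a => x /= px; rewrite leNgt; apply/negP => /ltW/(le_cdfR F).
by rewrite leNgt (lt_le_trans aP).
Qed.

Lemma QL_le F p x : 0 < p -> p <= cdfR F x -> QL F p <= x.
Proof. by move=> p0 px; apply: ge_inf => //; exact: cdfR_ge_lbound. Qed.

Lemma cdfR_lt_quantile F p x : 0 < p -> x < QL F p -> cdfR F x < p.
Proof.
by move=> p0; rewrite !ltNge; apply: contra; exact: QL_le.
Qed.

(** Every point strictly to the right of the infimum has cdf at least [p], and right-continuity
    carries this to the infimum itself. *)
Lemma cdfR_ge_quantile F p : 0 < p -> p < 1 -> p <= cdfR F (QL F p).
Proof.
move=> p0 p1; apply: cvgr_to_ge (@cdfR_right_continuous F _) _.
near=> y; have /inf_lt : inf [set x : R | p <= cdfR F x] < y.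
  by near: y; exact: nbhs_right_gt.
case.
  by have [x px] := cdfR_gt_nonempty F _ p1; exists x; exact: ltW.
by move=> z /= pz /ltW/(le_cdfR F); exact: le_trans.
Unshelve. all: by end_near. Qed.

Lemma cdfR_gt_quantile F p x : p < 1 -> QR F p < x -> p < cdfR F x.
Proof.
move=> p1 /inf_lt[]; first exact: cdfR_gt_nonempty.
by move=> z /= pz /ltW/(le_cdfR F); exact: lt_le_trans.
Qed.

(** Continuity from below along the closed rays ending at [x - 1/(n+1)]. This is how cdf bounds
    reach the mass strictly left of [x], also when [F] has an atom at [x]. *)
Lemma prob_rayo_le F p x : (forall y, y < x -> cdfR F y <= p) ->
  prob F `]-oo, x[ <= p.
Proof.
move=> Fp; pose G n := `]-oo, x - n.+1%:R^-1]%classic : set (measurableTypeR R).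
have GE : \bigcup_n G n = `]-oo, x[%classic.
  apply/seteqP; split => y /=; rewrite /G/=.
    move=> [n _] /=; rewrite !in_itv/= => /le_lt_trans; apply.
    by rewrite ltrBlDr ltrDl invr_gt0.
  rewrite in_itv/= => yx.
  have xy0 : 0 < x - y by rewrite subr_gt0.
  have [n] := ltr_add_invr xy0; rewrite add0r => nxy.
  by exists n => //=; rewrite in_itv/= lerBrDr -lerBrDl ltW.
rewrite -lee_fin -probE; last exact: measurable_itv.
rewrite -GE; apply: cvge_le (nondecreasing_cvg_mu _ _ _).
- near=> n; rewrite /= probE; last exact: measurable_itv.
  by rewrite lee_fin Fp// ltrBlDr ltrDl invr_gt0.
- by move=> n; exact: measurable_itv.
- by apply: bigcup_measurable => n _; exact: measurable_itv.
- move=> m n mn; apply/subsetPset => y; rewrite /G/= !in_itv/= => /le_trans; apply.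
  by rewrite lerD2l lerN2 lef_pV2 ?posrE// ler_nat.
Unshelve. all: by end_near. Qed.

Lemma prob_rayc F x : prob F `[x, +oo[ = 1 - prob F `]-oo, x[.
Proof. by rewrite -probC ?setCitvl//; exact: measurable_itv. Qed.
End quantile_lemmas.

(** * Consequences of membership in the family *)

Section family_lemmas.
Context {R : realType}.
Implicit Types (tbar B m2bar kappa u : R) (F : realDistr R).

Lemma half_le_cdfR_median F : 2^-1 <= cdfR F (median F).
Proof. by apply: cdfR_ge_quantile; lra. Qed.

Lemma cdfR_lt_half F x : x < median F -> cdfR F x < 2^-1.
Proof. by apply: cdfR_lt_quantile; lra. Qed.

Lemma prob_lt_median F : prob F `]-oo, median F[ <= 2^-1.
Proof. by apply: prob_rayo_le => y /cdfR_lt_half/ltW. Qed.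

Lemma QL_le_m1 tbar F : 0 < tbar -> tbar < 2^-1 ->
  QL F (2^-1 - tbar) <= m1 F.
Proof.
move=> t0 t1; apply: QL_le; first by lra.
by apply: le_trans (half_le_cdfR_median F); lra.
Qed.

Lemma m1_le_QR tbar F : 0 < tbar -> tbar < 2^-1 ->
  m1 F <= QR F (2^-1 + tbar).
Proof.
move=> t0 t1; apply: lb_le_inf; first by apply: cdfR_gt_nonempty; lra.
by move=> x /= Fx; rewrite leNgt; apply/negP => /cdfR_lt_half; lra.
Qed.

Lemma cdfR_growth tbar B m2bar kappa F x1 x2 : 0 < B ->
  in_family tbar B m2bar kappa F ->
  (QL F (2^-1 - tbar) <= x1 <= QR F (2^-1 + tbar)) ||
    (m1 F - 2 * m2 F <= x1 <= m1 F + 2 * m2 F) ->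
  (QL F (2^-1 - tbar) <= x2 <= QR F (2^-1 + tbar)) ||
    (m1 F - 2 * m2 F <= x2 <= m1 F + 2 * m2 F) ->
  x1 <= x2 -> x2 - x1 <= B * m2 F * (cdfR F x2 - cdfR F x1).
Proof.
move=> B0 [_ m2_gt0 growth _ _] S1 S2 x12.
have := growth x2 x1; rewrite !ger0_norm ?subr_ge0 ?le_cdfR//.
rewrite ler_pdivrMl ?mulr_gt0//; apply.
  by case/orP: S2 => ?; [left|right]; rewrite /= in_itv.
by case/orP: S1 => ?; [left|right]; rewrite /= in_itv.
Qed.

(** Across [[m1 - 2 m2, m1 + 2 m2]], of length [4 m2], assumption (i) makes the cdf climb by at
    least [4 / B], and no cdf climbs by more than 1. *)
Lemma family_B_ge4 tbar B m2bar kappa F : 0 < B ->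
  in_family tbar B m2bar kappa F -> 4 <= B.
Proof.
move=> B0 hF; have [_ m2_gt0 _ _ _] := hF.
have := cdfR_growth _ _ _ _ _ (m1 F - 2 * m2 F) (m1 F + 2 * m2 F) B0 hF.
have c1 := prob_le1 F _ (measurable_rayNy false (m1 F + 2 * m2 F)).
have c0 := prob_ge0 F `]-oo, m1 F - 2 * m2 F].
rewrite -cdfR_prob in c0; rewrite -cdfR_prob in c1.
rewrite (_ : _ || _ = true); last by apply/orP; right; lra.
rewrite (_ : _ || _ = true); last by apply/orP; right; lra.
move=> /(_ isT isT).
set c := cdfR F _ - cdfR F _ => H.
have c_le1 : c <= 1 by rewrite /c; lra.
have Bm2_gt0 : 0 < B * m2 F by rewrite mulr_gt0.
have {}H : m1 F + 2 * m2 F - (m1 F - 2 * m2 F) <= B * m2 F * c by apply: H; lra.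
have : 4 * m2 F <= B * m2 F * c by lra.
move/le_trans => /(_ (B * m2 F)); rewrite ler_piMr ?(ltW Bm2_gt0)//.
by move=> /(_ isT); rewrite ler_pM2r.
Qed.

(** The cdf starts from at least 1/2 at [m1] and grows at rate [1 / (B m2)] as long as the shifted
    point stays below the upper quantile; beyond that quantile it already exceeds [1/2 + tbar]. *)
Lemma cdfR_median_shift tbar B m2bar kappa F u : 0 < B -> tbar < 2^-1 ->
  in_family tbar B m2bar kappa F -> 0 <= u <= tbar ->
  2^-1 + u <= cdfR F (m1 F + B * m2 F * u).
Proof.
move=> B0 t1 hF /andP[u_ge0 u_le]; have [_ m2_gt0 _ _ _] := hF.
have Bm2_gt0 : 0 < B * m2 F by rewrite mulr_gt0.
have h_ge0 : 0 <= B * m2 F * u by rewrite mulr_ge0 ?(ltW Bm2_gt0).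
have Fm1 : 2^-1 <= cdfR F (m1 F) := half_le_cdfR_median F.
have [->|u_neq0] := eqVneq u 0; first by rewrite mulr0 !addr0.
have t0 : 0 < tbar by rewrite (lt_le_trans _ u_le)// lt0r u_neq0.
have [xQR|QRx] := leP (m1 F + B * m2 F * u) (QR F (2^-1 + tbar)); last first.
  have : 2^-1 + tbar < cdfR F (m1 F + B * m2 F * u).
    by apply: cdfR_gt_quantile QRx; lra.
  lra.
have : m1 F + B * m2 F * u - m1 F <=
       B * m2 F * (cdfR F (m1 F + B * m2 F * u) - cdfR F (m1 F)).
  have := QL_le_m1 tbar F t0 t1; have := m1_le_QR tbar F t0 t1 => ? ?.
  by apply: (cdfR_growth _ _ _ _ _ _ _ B0 hF); [apply/orP; left..|]; lra.
by rewrite [X in X <= _]addrAC subrr add0r ler_pM2l//; lra.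
Qed.

Lemma prob_lt_median_shift tbar B m2bar kappa F u : 0 < B -> tbar < 2^-1 ->
  in_family tbar B m2bar kappa F -> 0 <= u <= tbar ->
  prob F `]-oo, m1 F - B * m2 F * u[ <= 2^-1 - u.
Proof.
move=> B0 t1 hF /andP[u_ge0 u_le]; have [_ m2_gt0 _ _ _] := hF.
have Bm2_gt0 : 0 < B * m2 F by rewrite mulr_gt0.
have h_ge0 : 0 <= B * m2 F * u by rewrite mulr_ge0 ?(ltW Bm2_gt0).
have [->|u_neq0] := eqVneq u 0; first by rewrite mulr0 !subr0 prob_lt_median.
have t0 : 0 < tbar by rewrite (lt_le_trans _ u_le)// lt0r u_neq0.
apply: prob_rayo_le => y yx.
have [yQL|QLy] := ltP y (QL F (2^-1 - tbar)).
  have : cdfR F y < 2^-1 - tbar by apply: cdfR_lt_quantile yQL; lra.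
  lra.
(* The cdf may exceed 1/2 at [m1], so growth is measured from [y] to its translate, still strictly
   left of [m1], where the cdf is below 1/2. *)
have zm1 : y + B * m2 F * u < m1 F by lra.
have : y + B * m2 F * u - y <=
       B * m2 F * (cdfR F (y + B * m2 F * u) - cdfR F y).
  have := m1_le_QR tbar F t0 t1 => ?.
  by apply: (cdfR_growth _ _ _ _ _ _ _ B0 hF); [apply/orP; left..|]; lra.
rewrite [X in X <= _]addrAC subrr add0r ler_pM2l//.
by have := cdfR_lt_half _ _ zm1; lra.
Qed.

Lemma measurable_dist_lt (a c : R) :
  measurable ([set y | `|y - a| < c] : set (measurableTypeR R)).
Proof.
have := measurable_dist_to a measurableT (measurable_rayNy true c).
by rewrite setTI.
Qed.

(** With [g = B m2 u <= m2], the set [|y - m1| < m2 - g] and the strip []m1 - m2, m1 - m2 + g]] are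
    disjoint parts of [|y - m1| < m2], which has mass at most 1/2. Growth near [m1 - m2] gives the
    strip mass at least [u]. *)
Lemma prob_lt_mad_shift tbar B m2bar kappa F u : 0 < B -> tbar < 2^-1 ->
  in_family tbar B m2bar kappa F -> 0 <= u <= tbar ->
  prob F [set y | `|y - m1 F| < m2 F - B * m2 F * u] <= 2^-1 - u.
Proof.
move=> B0 t1 hF /andP[u_ge0 u_le]; have [_ m2_gt0 _ _ _] := hF.
have Bm2_gt0 : 0 < B * m2 F by rewrite mulr_gt0.
have h_ge0 : 0 <= B * m2 F * u by rewrite mulr_ge0 ?(ltW Bm2_gt0).
set g := B * m2 F * u in h_ge0 *.
have [gm2|m2g] := leP g (m2 F); last first.
  rewrite (_ : [set y | _] = set0) ?/prob ?measure0/=; first by lra.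
  apply/seteqP; split => y //= ylt.
  by have := normr_ge0 (y - m1 F); lra.
have mI : measurable (`]m1 F - m2 F, m1 F - m2 F + g]%classic :
    set (measurableTypeR R)) by exact: measurable_itv.
have : prob F ([set y | `|y - m1 F| < m2 F - g] `|`
               `]m1 F - m2 F, m1 F - m2 F + g]) <= 2^-1.
  apply: le_trans (prob_lt_median (absdev F (m1 F))).
  apply: (@le_trans _ _ (prob F [set y | `|y - m1 F| < m2 F])).
    apply: le_prob; [|exact: measurable_dist_lt|].
      by apply: measurableU => //; exact: measurable_dist_lt.
    by move=> y /= [|]; rewrite ?in_itv/= ?ltr_norml; lra.
  (* By conversion: the [absdev] mass of a ray is the mass under [F] of its preimage. *)
  exact: lexx.
rewrite probU; [|exact: measurable_dist_lt|exact: mI|]; last first.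
  by apply/seteqP; split => y //=; rewrite in_itv/= ltr_norml; lra.
rewrite prob_itvoc; last by lra.
have : m1 F - m2 F + g - (m1 F - m2 F) <=
       B * m2 F * (cdfR F (m1 F - m2 F + g) - cdfR F (m1 F - m2 F)).
  by apply: (cdfR_growth _ _ _ _ _ _ _ B0 hF); [apply/orP; right..|]; lra.
by rewrite [X in X <= _]addrAC subrr add0r ler_pM2l//; lra.
Qed.

(** If [|y - m1| <= m2], then [|y - m1|] lies in [[0, m2]] and hence within [m2] of [m2]. This has
    probability at least 1/2, so [m4 <= m2], and (iii) concludes. *)
Lemma family_kappa_ge1 tbar B m2bar kappa F : 0 <= kappa ->
  in_family tbar B m2bar kappa F -> 1 <= kappa.
Proof.
move=> k_ge0 [_ m2_gt0 _ _ mk].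
have m42 : m4 F <= m2 F.
  apply: QL_le; first lra.
  apply: le_trans (half_le_cdfR_median (absdev F (m1 F))) _.
  rewrite !cdfR_prob.
  suff : prob F (dist_to (m1 F) @^-1` `]-oo, m2 F]) <=
         prob F (dist_to (m1 F) @^-1` (dist_to (m2 F) @^-1` `]-oo, m2 F])) by [].
  have mV a A : measurable A ->
      measurable (dist_to a @^-1` A : set (measurableTypeR R)).
    by move=> mA; rewrite -[X in measurable X]setTI; exact: measurable_dist_to.
  have mI : measurable (`]-oo, m2 F]%classic : set (measurableTypeR R)).
    exact: measurable_itv.
  apply: le_prob; [exact: mV|exact: (mV _ _ (mV _ _ mI))|].
  move=> y /=; rewrite !in_itv/= /dist_to => ym; rewrite ler_norml.
  by have := normr_ge0 (y - m1 F); lra.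
rewrite -(ler_pM2r m2_gt0) mul1r (le_trans mk)//.
by rewrite ler_wpM2l.
Qed.
End family_lemmas.

(** * Chernoff's bound for a failed majority *)

Section chernoff_bound.
Context {R : realType} {d} {T : measurableType d} (P : probability T R).

(** Independence as a product rule on every full pattern of events and complements, the disjoint
    pieces over which the Chernoff sum runs. *)
Definition indep_events n (E : 'I_n -> set T) : Prop :=
  forall b : 'I_n -> bool,
    prob P (\bigcap_i (if b i then E i else ~` E i)) =
    \prod_i prob P (if b i then E i else ~` E i).

(** One Chernoff factor: weight [1 / lam] on success and [lam] on failure. As [lam >= 1], the mean
    weight decreases in [p]; at [p = 1/2 + y] its square is [1 - 4 y^2 <= exp(- 4 y^2)]. *)
Lemma balanced_weight (y : R) : 0 < y -> y < 2^-1 ->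
  exists2 lam : R, 1 <= lam &
    forall p, 2^-1 + y <= p -> p <= 1 ->
      p / lam + (1 - p) * lam <= expR (- (2 * y ^+ 2)).
Proof.
move=> y0 y1; pose r := (2^-1 + y) / (2^-1 - y).
have r1 : 1 <= r by rewrite ler_pdivlMr; lra.
have r0 : 0 <= r by lra.
(* This lam minimizes the left-hand side at p = 1/2 + y, where it becomes
   sqrt (1 - 4 y ^ 2). *)
pose lam := Num.sqrt r.
have lam2 : lam ^+ 2 = r by rewrite sqr_sqrtr.
have lam1 : 1 <= lam by rewrite -[1]sqrtr1 ler_sqrt// ; lra.
exists lam => // p py p1.
have lam0 : 0 < lam by lra.
apply: (@le_trans _ _ ((2^-1 + y) / lam + (2^-1 - y) * lam)).
  rewrite -subr_ge0.
  have -> : (2^-1 + y) / lam + (2^-1 - y) * lam - (p / lam + (1 - p) * lam) =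
     (p - (2^-1 + y)) * (lam - lam^-1) by field; lra.
  rewrite mulr_ge0 ?subr_ge0//.
  by rewrite (le_trans _ lam1)// invf_le1.
have v0 : 0 <= (2^-1 + y) / lam + (2^-1 - y) * lam.
  by rewrite addr_ge0 ?mulr_ge0 ?invr_ge0//; lra.
rewrite -ler_sqr ?nnegrE ?expR_ge0//.
rewrite -expRM_natl.
have -> : ((2^-1 + y) / lam + (2^-1 - y) * lam) ^+ 2 = 1 + - (4 * y ^+ 2).
  have -> : ((2^-1 + y) / lam + (2^-1 - y) * lam) ^+ 2 =
    (2^-1 + y) ^+ 2 / lam ^+ 2 + 2 * (2^-1 + y) * (2^-1 - y)
      + (2^-1 - y) ^+ 2 * lam ^+ 2.
    by field; lra.
  by rewrite lam2 /r; field; lra.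
rewrite (_ : 2%:R * _ = - (4 * y ^+ 2)); last by ring.
exact: expR_ge1Dx.
Qed.

Lemma sum_memE n (E : 'I_n -> set T) (p : pred nat) :
  [set w | p (\sum_(i < n) (w \in E i))%N] =
  \bigcup_(b in [set` [pred b : {ffun 'I_n -> bool} | p (\sum_(i < n) b i)%N]])
    \bigcap_i (if b i then E i else ~` E i).
Proof.
apply/seteqP; split => w /=.
  move=> pw; exists [ffun i => w \in E i].
    by rewrite /= inE; under eq_bigr do rewrite ffunE.
  by move=> i _; rewrite ffunE; case: ifPn => [/set_mem|/negP Ew /mem_set].
case=> b /=; rewrite inE => pb bw.
rewrite (eq_bigr (fun i => b i : nat))// => i _.
by have := bw i I; case: (b i) => Ew; rewrite ?(mem_set Ew) ?(memNset Ew).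
Qed.

Let measurable_pattern n (E : 'I_n -> set T) (b : {ffun 'I_n -> bool}) :
  (forall i, measurable (E i)) ->
  measurable (\bigcap_i (if b i then E i else ~` E i)).
Proof.
move=> mE; apply: fin_bigcap_measurable; first exact: finite_finset.
by move=> i _; case: ifP => _ //; exact: measurableC.
Qed.

Lemma measurable_sum_mem n (E : 'I_n -> set T) (p : pred nat) :
  (forall i, measurable (E i)) ->
  measurable [set w | p (\sum_(i < n) (w \in E i))%N].
Proof.
move=> mE; rewrite sum_memE; apply: fin_bigcup_measurable => // b _.
exact: measurable_pattern.
Qed.

Lemma chernoff_majority n (E : 'I_n -> set T) (y : R) :
  (forall i, measurable (E i)) -> indep_events n E ->
  0 < y -> y < 2^-1 -> (forall i, 2^-1 + y <= prob P (E i)) ->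
  prob P [set w | (2 * (\sum_(i < n) (w \in E i)) <= n)%N] <=
    expR (- (2 * y ^+ 2)) ^+ n.
Proof.
move=> mE indE y0 y1 pE.
have [lam lam1 lamP] := balanced_weight y y0 y1.
have lam0 : 0 < lam by rewrite (lt_le_trans ltr01).
rewrite (sum_memE _ E (fun s => 2 * s <= n)%N) prob_disjoint_sum; last 2 first.
- by move=> b; exact: measurable_pattern.
- move=> b c bc; apply/seteqP; split => w // [bw cw]; move/eqP: bc; apply.
  apply/ffunP => i; have := bw i I; have := cw i I.
  by case: (b i); case: (c i).
pose q i (b : bool) := prob P (if b then E i else ~` E i).
have q0 i b : 0 <= q i b by exact: prob_ge0.
pose wt (b : bool) := if b then lam^-1 else lam.
have wt0 b : 0 <= wt b by rewrite /wt; case: b; rewrite ?invr_ge0 (ltW lam0).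
(* The product of the weights is lam ^ (n - 2 s) >= 1 on a pattern b with
   s <= n / 2 ones. *)
apply: (@le_trans _ _ (\sum_(b : {ffun 'I_n -> bool})
    \prod_i (q i (b i) * wt (b i)))).
  rewrite big_mkcond/=; apply: ler_sum => b _; case: ifPn => [lb|_]; last first.
    by apply: prodr_ge0 => i _; rewrite mulr_ge0.
  rewrite indE big_split/= ler_peMr//; [by apply: prodr_ge0 => i _; exact: q0|].
  have : (\prod_(i < n) wt (b i)) * lam ^+ (2 * \sum_(i < n) b i)%N = lam ^+ n.
    rewrite big_distrr/= -prodrXr -big_split/= -[in RHS](card_ord n) -prodr_const.
    apply: eq_bigr => i _; rewrite /wt; case: (b i); last first.
      by rewrite muln0 expr0 mulr1.
    by rewrite muln1 expr2 mulrA mulVf ?mul1r// gt_eqF.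
  move=> prodE; rewrite -(ler_pM2r (exprn_gt0 (2 * \sum_(i < n) b i)%N lam0)).
  by rewrite mul1r prodE ler_weXn2l.
(* By distributivity the weighted sum over patterns is a product of mean weights, each bounded by
   [balanced_weight]. *)
rewrite -(bigA_distr_bigA (fun i b => q i b * wt b)).
rewrite -[X in _ ^+ X](card_ord n) -prodr_const; apply: ler_prod => i _.
rewrite big_bool /q /wt /= probC//.
rewrite addr_ge0 ?mulr_ge0 ?invr_ge0 ?prob_ge0 ?(ltW lam0)//=.
  by rewrite lamP// prob_le1.
by rewrite subr_ge0 prob_le1.
Qed.
End chernoff_bound.

(** * Deterministic bounds on the empirical median and MAD from a strict majority *)

Section empirical_median_bounds.
Context {R : realType}.
Implicit Types (s : seq R) (c : R).

(** The entries at most [c] come first in sorted order, and a strict majority of them reaches past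
    the middle index, hence covers both middle values when the size is even. *)
Lemma emp_median_le s c :
  (size s < 2 * count (fun x => x <= c)%R s)%N -> emp_median s <= c.
Proof.
move=> sc; rewrite /emp_median.
have nth_le j : (j < count (fun x => x <= c)%R s)%N -> (sort <=%R s)`_j <= c.
  rewrite -(count_sort <=%R) => jc.
  by apply: nth_count_le => //; exact: sort_le_sorted.
have sE := odd_double_half (size s); rewrite -mul2n in sE.
have cs : (count (fun x => x <= c)%R s <= size s)%N by rewrite count_size.
case: ifPn => [so|/negbTE so]; rewrite so in sE.
  by apply: nth_le; lia.
have h1 := nth_le (size s)./2 ltac:(lia).
have h2 := nth_le (size s)./2.-1 ltac:(lia).
lra.
Qed.

Lemma emp_median_ge s c :
  (size s < 2 * count (fun x => c <= x)%R s)%N -> c <= emp_median s.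
Proof.
move=> sc; rewrite /emp_median.
have nth_ge j : (count (fun x => x < c)%R s <= j < size s)%N ->
    c <= (sort <=%R s)`_j.
  rewrite -(count_sort <=%R) -(size_sort <=%R) => jc.
  by apply: nth_count_ge => //; exact: sort_le_sorted.
have cE : count (fun x => x < c)%R s = (size s - count (fun x => c <= x)%R s)%N.
  exact: count_lt_ge.
have sE := odd_double_half (size s); rewrite -mul2n in sE.
have cs : (count (fun x => c <= x)%R s <= size s)%N by rewrite count_size.
case: ifPn => [so|/negbTE so]; rewrite so in sE.
  by apply: nth_ge; lia.
have h1 := nth_ge (size s)./2 ltac:(lia).
have h2 := nth_ge (size s)./2.-1 ltac:(lia).
lra.
Qed.

(** Recentring from [m] to the empirical median changes each absolute deviation by at most [h]. *)
Lemma emp_mad_ge (s : seq R) (m v h : R) :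
  `|emp_median s - m| <= h ->
  (size s < 2 * count (fun x => v <= `|x - m|)%R s)%N -> v - h <= emp_mad s.
Proof.
move=> mh sv; apply: emp_median_ge; rewrite size_map count_map.
apply: leq_trans sv _; rewrite leq_pmul2l//; apply: sub_count => x /= vx.
have : `|x - m| <= `|x - emp_median s| + `|emp_median s - m|.
  by rewrite (le_trans _ (ler_normD _ _))// addrA subrK.
lra.
Qed.

End empirical_median_bounds.

(** * Measurability of the empirical median and MAD *)

Section empirical_median_measurable.
Context {R : realType} {d} {T : measurableType d} {I : Type}.
Implicit Types (f : I -> T -> R) (s : seq I).

Lemma measurable_count_lt f s c j : (forall i, measurable_fun setT (f i)) ->
  measurable [set w | (j < count (fun x => x < c)%R [seq f i w | i <- s])%N].
Proof.
move=> mf; have mfc i : measurable [set w | f i w < c].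
  have := mf i measurableT _ (measurable_rayNy true c); rewrite setTI.
  by congr measurable.
elim: s j => [|i s IH] j /=.
  by rewrite (_ : [set _ | _] = set0)//; apply/seteqP; split.
case: j => [|j].
  rewrite (_ : [set _ | _] = [set w | f i w < c] `|`
    [set w | (0 < count (fun x => x < c)%R [seq f i w | i <- s])%N]).
    exact: measurableU.
  by apply/seteqP; split => w /=; rewrite addn_gt0 lt0b => /orP.
rewrite (_ : [set _ | _] = ([set w | f i w < c] `&`
    [set w | (j < count (fun x => x < c)%R [seq f i w | i <- s])%N]) `|`
    [set w | (j.+1 < count (fun x => x < c)%R [seq f i w | i <- s])%N]).
  by apply: measurableU => //; exact: measurableI.
apply/seteqP; split => w /=.
  case: (f i w < c) => /=; last by right.
  by rewrite add1n ltnS; left.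
by case: (f i w < c); rewrite /= ?add1n ?add0n ?ltnS => -[[]//|] // /ltnW.
Qed.

(** The order statistic of index [j] is below [c] exactly when more than [j] entries are. Out of
    range, [nth] returns the constant 0. *)
Lemma measurable_order_stat f s j : (forall i, measurable_fun setT (f i)) ->
  measurable_fun setT (fun w => (sort <=%R [seq f i w | i <- s])`_j).
Proof.
move=> mf; have [js|sj] := ltnP j (size s); last first.
  rewrite (_ : (fun w => _) = cst 0)//.
  by apply/funext => w; rewrite nth_default// size_sort size_map.
apply: (measurability _ (RGenInftyO.measurableE R)) => _ [_ [c ->] <-].
rewrite setTI (_ : _ @^-1` _ =
    [set w | (j < count (fun x => x < c)%R [seq f i w | i <- s])%N]).
  exact: measurable_count_lt.
apply/seteqP; split => w /=; rewrite in_itv/= -(count_sort <=%R); last first.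
  by apply: nth_count_lt; exact: sort_le_sorted.
rewrite !ltnNge; apply: contraL => cj; rewrite -leNgt.
apply: nth_count_ge; first exact: sort_le_sorted.
by rewrite cj size_sort size_map.
Qed.

Lemma measurable_emp_median f s : (forall i, measurable_fun setT (f i)) ->
  measurable_fun setT (fun w => emp_median [seq f i w | i <- s]).
Proof.
move=> mf; rewrite /emp_median.
have [so|/negbTE so] := boolP (odd (size s)); under eq_fun do rewrite /= size_map so.
  exact: measurable_order_stat.
apply: measurable_funM => //.
by apply: measurable_funD; exact: measurable_order_stat.
Qed.

Lemma measurable_emp_mad f s : (forall i, measurable_fun setT (f i)) ->
  measurable_fun setT (fun w => emp_mad [seq f i w | i <- s]).
Proof.
move=> mf; rewrite /emp_mad; under eq_fun do rewrite -map_comp.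
apply: (measurable_emp_median
  (fun i w => `|f i w - emp_median [seq f i w | i <- s]|)) => i.
apply: measurableT_comp => //.
by apply: measurable_funB => //; exact: measurable_emp_median.
Qed.

End empirical_median_measurable.

(** * The tolerance and the number of pulls *)

Section sample_size.
Context {R : realType}.
Implicit Types (adv : adversary) (tbar B m2bar eps alpha delta : R).

(* The deviation, on the scale of the cdf, that the sample size is tuned to. *)
Definition tolerance adv tbar B m2bar eps alpha : R :=
  Num.min (alpha / (2 * B * m2bar)) (tbar - eff_contamination adv eps).

Lemma eps_lt_quarter adv tbar B eps : 4 <= B -> 0 < eps < eps_max adv tbar B ->
  eps < 4^-1.
Proof.
move=> B4 /andP[_ epsmax].
have B_inv : B^-1 <= 4^-1 by rewrite lef_pV2 ?posrE//; lra.
apply: lt_le_trans epsmax (le_trans _ B_inv).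
by case: adv => /=; rewrite ge_min lexx orbT.
Qed.

Lemma eff_contamination_ge0 adv eps : 0 < eps -> eps < 4^-1 ->
  0 <= eff_contamination adv eps.
Proof. by move=> e0 e1; case: adv => /=; rewrite ?divr_ge0//; lra. Qed.

Lemma eff_contamination_lt adv tbar B eps : 0 < tbar -> eps < 4^-1 ->
  0 < eps < eps_max adv tbar B -> eff_contamination adv eps < tbar.
Proof.
move=> t0 e1 /andP[e0]; rewrite /eps_max /eff_contamination.
by case: adv; rewrite lt_min => /andP[]//; rewrite ltr_pdivlMr ?ltr_pdivrMr; lra.
Qed.

(** The two entries of the maximum are the inverse squares of the two entries of the minimum
    defining [tolerance]. *)
Lemma sqr_tolerance_ge adv tbar B m2bar eps alpha :
  0 < alpha -> 0 < B -> 0 < m2bar -> eff_contamination adv eps < tbar ->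
  1 <= Num.max (4 * B ^+ 2 * m2bar ^+ 2 / alpha ^+ 2)
               ((tbar - eff_contamination adv eps) ^- 2) *
       tolerance adv tbar B m2bar eps alpha ^+ 2.
Proof.
move=> a0 B0 m0 et; rewrite /tolerance.
set g := tbar - _; have g0 : 0 < g by rewrite subr_gt0.
have [_|_] := leP (alpha / (2 * B * m2bar)) g.
  rewrite -ler_pdivrMr ?exprn_gt0 ?divr_gt0 ?mulr_gt0// le_max; apply/orP; left.
  rewrite le_eqVlt; apply/orP; left; apply/eqP.
  by field; rewrite !gt_eqF.
rewrite -ler_pdivrMr ?exprn_gt0// le_max; apply/orP; right.
by rewrite mul1r.
Qed.

Lemma chernoff_pulls adv tbar B m2bar eps (k : nat) alpha delta :
  0 < alpha -> 0 < B -> 0 < m2bar -> eff_contamination adv eps < tbar ->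
  (0 < k)%N -> 0 < delta < 1 ->
  expR (- (2 * (3 / 4 * tolerance adv tbar B m2bar eps alpha) ^+ 2))
    ^+ pulls adv tbar B m2bar eps k alpha delta <= delta / k%:R ^+ 2.
Proof.
move=> a0 B0 m0 et k0 /andP[d0 d1].
have k1 : 1 <= k%:R :> R by rewrite ler1n.
pose c : R := if adv is Malicious then 3 else 2.
have c2 : 2 <= c by rewrite /c; case: (adv) => //; rewrite ler_nat.
pose q : R := c * k%:R / delta.
have q0 : 0 < q by rewrite /q divr_gt0// mulr_gt0//; lra.
have q1 : 1 <= q.
  by rewrite /q ler_pdivlMr// mul1r; apply: le_trans (ltW d1) _; nra.
have L0 : 0 <= ln q by rewrite ln_ge0.
set x := tolerance _ _ _ _ _ _; set n := pulls _ _ _ _ _ _ _ _.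
have nx : 2 * ln q <= n%:R * x ^+ 2.
  have := sqr_tolerance_ge adv tbar B m2bar eps alpha a0 B0 m0 et.
  rewrite -/x; set M := Num.max _ _ => Mx.
  have M0 : 0 <= M.
    by rewrite le_max invr_ge0 sqr_ge0 orbT.
  have Mn : 2 * M * ln q <= n%:R.
    have bE : budget adv tbar B m2bar eps k alpha delta = 2 * M * ln q by [].
    have cg := ceil_ge (2 * M * ln q).
    have b0 : 0 <= 2 * M * ln q by rewrite !mulr_ge0.
    rewrite /n /pulls bE natr_absz ger0_norm//.
    by rewrite -(ler0z R); apply: le_trans b0 cg.
  apply: (@le_trans _ _ (2 * M * ln q * x ^+ 2)); last first.
    by rewrite ler_wpM2r ?sqr_ge0.
  by rewrite mulrAC ler_wpM2r// -mulrA ler_peMr.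
rewrite -expRM_natr.
(* Inserts [q^-2 * q^2 = 1]. The Chernoff exponent is [9/8 n x^2 >= 9/4 ln q >= 2 ln q], and
   [q^-2 <= delta / k^2] reduces to [delta <= c^2]. *)
have -> : delta / k%:R ^+ 2 = delta / k%:R ^+ 2 * expR (- (2 * ln q)) * q ^+ 2.
  rewrite expRN expRM_natl lnK ?posrE// -mulrA mulVf ?mulr1// expf_neq0//.
  by rewrite gt_eqF.
apply: (@le_trans _ _ (expR (- (2 * ln q)))).
  rewrite ler_expR; nra.
rewrite mulrAC ler_peMl ?expR_ge0//.
have -> : delta / k%:R ^+ 2 * q ^+ 2 = c ^+ 2 / delta.
  by rewrite /q; field; rewrite !gt_eqF//; lra.
by rewrite ler_pdivlMr// mul1r; nra.
Qed.

End sample_size.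

(** * Independence and probability of clean samples *)

Section clean_samples.
Context {R : realType} {d} {T : measurableType d} (P : probability T R).

Lemma independent_seq_indep_events {d'} {T' : measurableType d'}
    (X : nat -> T -> T') (A : set T') (J : seq nat) :
  (forall t, measurable_fun setT (X t)) -> measurable A -> uniq J ->
  independent_seq P X ->
  indep_events P (size J) (fun i => X (nth 0 J i) @^-1` A).
Proof.
move=> mX mA uJ indX b.
(* Moves the pattern from positions in [J] to times; the default [true] occurs only at times outside
   [J]. *)
pose b' t := oapp b true (insub (index t J)).
have b'E (i : 'I_(size J)) : b' (nth 0 J i) = b i.
  by rewrite /b' index_uniq// valK.
pose A' t := if b' t then A else ~` A.
have mA' t : measurable (A' t) by rewrite /A'; case: ifP => _ //; exact: measurableC.
have mXA t : measurable (X t @^-1` A' t).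
  by rewrite -[X in measurable X]setTI; exact: mX.
have XA' (i : 'I_(size J)) :
    (if b i then X (nth 0 J i) @^-1` A else ~` (X (nth 0 J i) @^-1` A))
    = X (nth 0 J i) @^-1` A' (nth 0 J i).
  by rewrite /A' b'E; case: (b i).
apply: EFin_inj; under eq_bigr do rewrite XA'.
rewrite -(big_mkord xpredT (fun i => prob P (X (nth 0 J i) @^-1` A' (nth 0 J i)))).
rewrite -(big_nth 0 xpredT (fun t => prob P (X t @^-1` A' t))).
rewrite -prodEFin (eq_bigr (fun t => P (X t @^-1` A' t))); last first.
  by move=> t _; rewrite -probE.
rewrite -indX// -probE; last first.
  apply: fin_bigcap_measurable => [|i _]; first exact: finite_finset.
  by rewrite XA'.
congr (P _); apply/seteqP; split => w Xw.
  move=> t /= tJ; have ti : (index t J < size J)%N by rewrite index_mem.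
  by have := Xw (Ordinal ti) I; rewrite XA'/= nth_index.
by move=> i _; rewrite XA'; apply: Xw => /=; rewrite mem_nth.
Qed.

Variables (k : nat) (Y : 'I_k -> nat -> {RV P >-> R})
  (D : 'I_k -> nat -> {RV P >-> bool}) (Z : 'I_k -> nat -> {RV P >-> R}).

Definition clean (A : set R) (i : 'I_k) (t : nat) : set T :=
  Y i t @^-1` A `&` D i t @^-1` [set false].

Lemma clean_observed A i t w : clean A i t w -> A (observed Y D Z i t w).
Proof.
by rewrite /observed => -[/= Aw ->]; rewrite subr0 mul1r mul0r addr0.
Qed.

Lemma measurable_clean A i t : measurable A -> measurable (clean A i t).
Proof.
move=> mA; apply: measurableI; rewrite -[X in measurable X]setTI.
  exact: measurable_funP.
exact: measurable_funP.
Qed.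

Lemma measurable_observed i t : measurable_fun setT (observed Y D Z i t).
Proof.
have mD : measurable_fun setT (fun w => (D i t w)%:R : R).
  by apply: (@measurableT_comp _ _ _ _ _ _ (fun b : bool => b%:R : R)) => //.
by apply: measurable_funD; apply: measurable_funM => //; exact: measurable_funB.
Qed.

Variables (adv : adversary) (eps tbar B m2bar alpha : R) (F : 'I_k -> realDistr R).
Hypothesis model : contamination_model Y D Z adv eps F.

Lemma clean_indep A i (J : seq nat) : measurable A -> uniq J ->
  indep_events P (size J) (fun j => clean A i (nth 0 J j)).
Proof.
move=> mA uJ; have m0 : measurable ([set false] : set bool) by [].
have mYD t : measurable_fun setT (fun w => (Y i t w, D i t w)).
  exact: measurable_fun_pair.
have mYDZ t : measurable_fun setT (fun w => (Y i t w, D i t w, Z i t w)).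
  by apply: measurable_fun_pair.
have [_ _] := model.
have pairE t : clean A i t = (fun w => (Y i t w, D i t w)) @^-1` (A `*` [set false]).
  by [].
(* The oblivious model states independence for triples, so the third coordinate is left free. *)
have tripleE t : clean A i t =
    (fun w => (Y i t w, D i t w, Z i t w)) @^-1` (A `*` [set false] `*` setT).
  by apply/seteqP; split => w /=; [move=> [? ?]|case].
case: adv => [[indX _]|[indX _]|indX].
- rewrite (_ : (fun j => _) = fun j : 'I_(size J) => (fun w =>
      (Y i (nth 0 J j) w, D i (nth 0 J j) w, Z i (nth 0 J j) w))
        @^-1` (A `*` [set false] `*` setT)); last first.
    by apply/funext => j; exact: tripleE.
  apply: (independent_seq_indep_events
    (fun t w => (Y i t w, D i t w, Z i t w)) (A `*` [set false] `*` setT)) => //.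
  by do 2 apply: measurableX => //.
- apply: (independent_seq_indep_events
    (fun t w => (Y i t w, D i t w)) (A `*` [set false])) => //.
  exact: measurableX.
- apply: (independent_seq_indep_events
    (fun t w => (Y i t w, D i t w)) (A `*` [set false])) => //.
  exact: measurableX.
Qed.

(** When [Y] and [D] are independent, [(1/2 + eps / (2 (1 - eps)) + x) (1 - eps) = 1/2 + (1 - eps)
    x], and [1 - eps > 3/4]. Against a malicious adversary, a union bound loses [eps], exactly the
    effective contamination, leaving [1/2 + x]. *)
Lemma prob_clean A i t x : measurable A -> 0 < eps -> eps < 4^-1 -> 0 <= x ->
  2^-1 + (eff_contamination adv eps + x) <= prob (F i) A ->
  2^-1 + 3 / 4 * x <= prob P (clean A i t).
Proof.
move=> mA e0 e1 x0 pA; have [YF Deps] := model.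
have mY : measurable (Y i t @^-1` A).
  by rewrite -[X in measurable X]setTI; exact: measurable_funP.
have mD b : measurable (D i t @^-1` [set b]).
  by rewrite -[X in measurable X]setTI; exact: measurable_funP.
have pY : prob P (Y i t @^-1` A) = prob (F i) A.
  by rewrite /prob -(YF i t A mA).
have pD b : prob P (D i t @^-1` [set b]) = if b then eps else 1 - eps.
  rewrite /prob -[P _]/(distribution P (D i t) [set b]) Deps.
  rewrite bernoulli_probE; last lra.
  have in1 (a c : bool) : (a \in [set c]) = (a == c).
    by apply/idP/eqP; rewrite inE.
  by case: b; rewrite !diracE !in1 /= /unstable.onem ?mulr0 ?mulr1 ?addr0 ?add0r.
have pYD : independent_pair P (Y i t) (D i t) ->
    prob P (clean A i t) = prob (F i) A * (1 - eps).
  move=> ind; apply: EFin_inj.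
  rewrite -probE; last exact: measurable_clean.
  by rewrite [LHS]ind// EFinM -pY -(pD false) -!probE.
have e1_gt0 : 1 - eps > 0 by lra.
move: pA; rewrite /eff_contamination; case: adv => /= pA.
- case=> _ /(_ i t)/pYD ->.
  apply: le_trans (ler_wpM2r (ltW e1_gt0) pA).
  rewrite (_ : (_ + (_ + x)) * _ = 2^-1 + (1 - eps) * x); last first.
    by field; rewrite gt_eqF//; lra.
  by rewrite lerD2l ler_wpM2r//; lra.
- case=> _ /(_ i t)/pYD ->.
  apply: le_trans (ler_wpM2r (ltW e1_gt0) pA).
  rewrite (_ : (_ + (_ + x)) * _ = 2^-1 + (1 - eps) * x); last first.
    by field; rewrite gt_eqF//; lra.
  by rewrite lerD2l ler_wpM2r//; lra.
- move=> _; have : prob P (Y i t @^-1` A) <=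
      prob P (clean A i t `|` D i t @^-1` [set true]).
    apply: le_prob => //; first by apply: measurableU => //; exact: measurable_clean.
    by move=> w /= Aw; case E : (D i t w); [right|left; split].
  rewrite probU//; last 2 first.
  - exact: measurable_clean.
  - by apply/seteqP; split => w //= [[_ /= ->]].
  by rewrite pY pD; lra.
Qed.

End clean_samples.

Lemma count_sum_nth {I : Type} (i0 : I) (p : pred I) (s : seq I) :
  count p s = (\sum_(j < size s) p (nth i0 s j))%N.
Proof.
rewrite -sum1_count big_mkcond/= (big_nth i0) big_mkord.
by apply: eq_bigr => j _; case: ifP.
Qed.

(** * Failure events of a single arm *)

Section good_event.
Context {R : realType} {d} {T : measurableType d} (P : probability T R).
Variables (k : nat) (Y : 'I_k -> nat -> {RV P >-> R})
  (D : 'I_k -> nat -> {RV P >-> bool}) (Z : 'I_k -> nat -> {RV P >-> R})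
  (sched : seq 'I_k).

Definition pull_times (i : 'I_k) : seq nat :=
  [seq t <- iota 0 (size sched) | nth i sched t == i].

Lemma samplesE i w :
  samples Y D Z sched i w = [seq observed Y D Z i t w | t <- pull_times i].
Proof. by []. Qed.

Lemma size_pull_times i : size (pull_times i) = count_mem i sched.
Proof.
rewrite size_filter -[in RHS](mkseq_nth i sched) count_map.
by apply: eq_count => t.
Qed.

Lemma pull_times_uniq i : uniq (pull_times i).
Proof. by rewrite filter_uniq// iota_uniq. Qed.

(** The event involves only [Y] and [D], so its probability can be bounded whatever the
    contamination [Z] is. *)
Definition few_clean (a : pred R) (i : 'I_k) : set T :=
  [set w | (2 * (\sum_(j < size (pull_times i))
    (w \in clean P k Y D [set x | a x] i (nth 0 (pull_times i) j)))
     <= size (pull_times i))%N].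

Lemma many_clean_count a i w : ~ few_clean a i w ->
  (size (samples Y D Z sched i w) < 2 * count a (samples Y D Z sched i w))%N.
Proof.
move=> /negP; rewrite -ltnNge samplesE size_map => /leq_trans; apply.
rewrite leq_pmul2l// count_map (count_sum_nth 0%N).
apply: leq_sum => j _; case: (boolP (_ \in _)) => // /set_mem cl; rewrite lt0b.
exact: (clean_observed _ _ _ _ Z _ _ _ _ cl).
Qed.

Lemma measurable_few_clean (a : pred R) i : measurable [set x | a x] ->
  measurable (few_clean a i).
Proof.
move=> ma; apply: (measurable_sum_mem _ _ (fun s => 2 * s <= _)%N) => j.
exact: measurable_clean.
Qed.

End good_event.

(** * Failure probability and error accounting for one arm *)

Section arm_bounds.
Context {R : realType} {d} {T : measurableType d} (P : probability T R).

Lemma measurable_le_fun (f g : T -> R) : measurable_fun setT f ->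
  measurable_fun setT g -> measurable [set w | f w <= g w].
Proof.
move=> mf mg; have := measurable_funB mg mf measurableT (measurable_itv `[0, +oo[).
rewrite setTI; congr measurable; apply/seteqP.
by split => w /=; rewrite in_itv/= andbT subr_ge0.
Qed.

Lemma prob_few_clean (k : nat) (Y : 'I_k -> nat -> {RV P >-> R})
  (D : 'I_k -> nat -> {RV P >-> bool}) (Z : 'I_k -> nat -> {RV P >-> R})
  (sched : seq 'I_k) adv eps tbar (F : 'I_k -> realDistr R) (a : pred R) i x :
  contamination_model Y D Z adv eps F -> 0 < eps -> eps < 4^-1 ->
  0 < x -> x <= tbar -> tbar < 2^-1 -> measurable [set y | a y] ->
  2^-1 + (eff_contamination adv eps + x) <= prob (F i) [set y | a y] ->
  prob P (few_clean P k Y D sched a i) <=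
    expR (- (2 * (3 / 4 * x) ^+ 2)) ^+ count_mem i sched.
Proof.
move=> model e0 e1 x0 xt t1 ma pa.
rewrite -size_pull_times; apply: chernoff_majority.
- by move=> j; exact: measurable_clean.
- by apply: (clean_indep _ _ _ _ Z _ _ _ model) => //; exact: pull_times_uniq.
- lra.
- lra.
- by move=> j; apply: (prob_clean _ _ _ _ Z _ _ _ model) => //; exact: ltW.
Qed.

(** The errors of median and MAD add up to [(1 + 2 t B) h <= (1/2 + t B) alpha + (1 + 2 t B) U]. The
    announced slack exceeds this by [t B (2 kappa - 1) (alpha + U)], nonnegative since
    [kappa >= 1]. *)
Lemma lower_estimate_le (med mad m v h t B kappa alpha U : R) :
  med <= m + h -> v - 2 * h <= mad -> h <= U + alpha / 2 ->
  0 <= t -> 0 < B -> 1 <= kappa -> 0 < alpha -> 0 <= U ->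
  med - t * B * mad -
    ((2^-1 + 2 * kappa * t * B) * alpha + (1 + (1 + 2 * kappa) * B * t) * U)
    <= m - B * v * t.
Proof.
move=> medh madv hU t0 B0 k1 a0 U0.
have c0 : 0 <= t * B by rewrite mulr_ge0// ltW.
have h1 := ler_wpM2l c0 madv.
have h2 := ler_wpM2l c0 hU.
have h3 : 0 <= (t * B) * (kappa - 1) * alpha.
  by apply: mulr_ge0 (ltW a0); apply: mulr_ge0; rewrite ?subr_ge0.
have h4 : 0 <= (t * B) * (kappa - 1) * U.
  by apply: mulr_ge0 U0; apply: mulr_ge0; rewrite ?subr_ge0.
have h5 : 0 <= t * B * alpha by apply: mulr_ge0 c0 (ltW a0).
have h6 : 0 <= t * B * U by apply: mulr_ge0.
lra.
Qed.

End arm_bounds.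

Theorem theorem22 (R : realType) (d : measure_display) (T : measurableType d)
  (P : probability T R) (k : nat) (tbar B m2bar kappa : R)
  (F : 'I_k -> realDistr R) (adv : adversary) (eps alpha delta : R)
  (Y : 'I_k -> nat -> {RV P >-> R}) (D : 'I_k -> nat -> {RV P >-> bool})
  (Z : 'I_k -> nat -> {RV P >-> R})
  (sched : seq 'I_k) (Ihat : T -> 'I_k) (Yout : {RV P >-> R})
  (hk : (2 <= k)%N)
  (htbar : 0 < tbar < 2^-1) (hB : 0 < B) (hm2bar : 0 < m2bar)
  (hkappa : 0 <= kappa)
  (hF : forall i, in_family tbar B m2bar kappa (F i))
  (heps : 0 < eps < eps_max adv tbar B)
  (halpha : 0 < alpha) (hdelta : 0 < delta < 1)
  (hmodel : contamination_model Y D Z adv eps F)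
  (halg : uniform_exploration Y D Z
            (pulls adv tbar B m2bar eps k alpha delta) sched Ihat)
  (hYout : forall (i : 'I_k) (A : set R), measurable A ->
     P (Ihat @^-1` [set i] `&` Yout @^-1` A)
     = (P (Ihat @^-1` [set i]) * F i A)%E) :
  let m1hat w := emp_median (samples Y D Z sched (Ihat w) w) in
  let m2hat w := emp_mad (samples Y D Z sched (Ihat w) w) in
  let U := Ubar adv B m2bar eps in
  forall t : R, 0 <= t <= tbar ->
    ((2^-1 + t - 3 * delta / k%:R)%:E <=
     P [set w | ((m1hat w - t * B * m2hat w)
                 - ((2^-1 + 2 * kappa * t * B) * alpha
                    + (1 + (1 + 2 * kappa) * B * t) * U) <= Yout w)%R])%E.
Proof.
move=> m1hat m2hat U t /andP[t0 tt].
have k0 : (0 < k)%N by apply: leq_trans hk.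
have [tbar0 tbar1] := andP htbar.
have [delta0 delta1] := andP hdelta.
have [eps0 _] := andP heps.
pose i0 := Ordinal k0.
have B4 : 4 <= B := family_B_ge4 _ _ _ _ _ hB (hF i0).
have kappa1 : 1 <= kappa := family_kappa_ge1 _ _ _ _ _ hkappa (hF i0).
have eps4 : eps < 4^-1 := eps_lt_quarter _ _ _ _ B4 heps.
have e0 := eff_contamination_ge0 adv _ eps0 eps4.
have et := eff_contamination_lt _ _ _ _ tbar0 eps4 heps.
have U0 : 0 <= U by rewrite /U /Ubar !mulr_ge0// ltW.
pose e := eff_contamination adv eps.
pose x := tolerance adv tbar B m2bar eps alpha.
have x0 : 0 < x by rewrite /x lt_min subr_gt0 et divr_gt0// !mulr_gt0.
have xet : e + x <= tbar by rewrite -lerBrDl /x /tolerance ge_min lexx orbT.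
have u_itv : 0 <= e + x <= tbar by rewrite xet addr_ge0// ltW.
have [pulled mIhat argmax] := halg.
pose h i := B * m2 (F i) * (e + x).
(* [B m2bar e] is [U], and the first entry of the minimum in [tolerance] gives
   [B m2bar x <= alpha / 2]. *)
have hU i : h i <= U + alpha / 2.
  have [_ m2_gt0 _ m2_le _] := hF i.
  apply: (@le_trans _ _ (B * m2bar * (e + x))).
    by rewrite ler_wpM2r ?addr_ge0// ?(ltW x0)// ler_wpM2l// ltW.
  rewrite mulrDr lerD2l.
  apply: (@le_trans _ _ (B * m2bar * (alpha / (2 * B * m2bar)))).
    by rewrite ler_wpM2l ?ge_min ?lexx// mulr_ge0// ltW.
  by rewrite le_eqVlt; apply/orP; left; apply/eqP; field; rewrite !gt_eqF.
(* [option bool] serves as a three-element index: median from above, median from below, MAD from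
   below. *)
pose ineq (i : 'I_k) (j : option bool) : pred R :=
  match j with
  | None => fun y => y <= m1 (F i) + h i
  | Some true => fun y => m1 (F i) - h i <= y
  | Some false => fun y => m2 (F i) - h i <= `|y - m1 (F i)|
  end.
have mineq i j : measurable ([set y | ineq i j y] : set (measurableTypeR R)).
  case: j => [[]|] /=.
  - have := measurable_itv `[m1 (F i) - h i, +oo[.
    by congr measurable; apply/seteqP; split => y; rewrite /= in_itv/= andbT.
  - rewrite (_ : [set y | _] = ~` [set y | `|y - m1 (F i)| < m2 (F i) - h i]).
      by apply: measurableC; exact: measurable_dist_lt.
    by apply/seteqP; split => y /=; rewrite leNgt => /negP.
  - exact: (measurable_rayNy false).
have pineq i j : 2^-1 + (e + x) <= prob (F i) [set y | ineq i j y].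
  case: j => [[]|] /=.
  - rewrite (_ : [set y | _] = `[m1 (F i) - h i, +oo[%classic); last first.
      by apply/seteqP; split => y; rewrite /= in_itv/= andbT.
    rewrite prob_rayc.
    have := prob_lt_median_shift _ _ _ _ _ _ hB tbar1 (hF i) u_itv.
    by rewrite -/(h i); lra.
  - rewrite (_ : [set y | _] = ~` [set y | `|y - m1 (F i)| < m2 (F i) - h i]).
      rewrite probC; last exact: measurable_dist_lt.
      have := prob_lt_mad_shift _ _ _ _ _ _ hB tbar1 (hF i) u_itv.
      by rewrite -/(h i); lra.
    by apply/seteqP; split => y /=; rewrite leNgt => /negP.
  - exact: (cdfR_median_shift _ _ _ _ _ _ hB tbar1 (hF i) u_itv).
(* Failures are collected over all arms because [Ihat] depends on the samples; none of them depends
   on [t], so the same failure event serves every [t]. *)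
pose Bad (ij : 'I_k * option bool) :=
  few_clean P k Y D sched (ineq ij.1 ij.2) ij.1.
have mBad ij : measurable (Bad ij).
  exact: (measurable_few_clean P k Y D sched _ _ (mineq ij.1 ij.2)).
have mBadU : measurable (\bigcup_ij Bad ij).
  by apply: fin_bigcup_measurable => //; exact: finite_finset.
have pBad : prob P (\bigcup_ij Bad ij) <= 3 * delta / k%:R.
  apply: (@le_trans _ _ (#|{: 'I_k * option bool}|%:R * (delta / k%:R ^+ 2))).
    apply: (prob_union_le P _ Bad _ mBad) => -[i j].
    apply: le_trans (chernoff_pulls adv tbar B m2bar eps k alpha delta
      halpha hB hm2bar et k0 hdelta).
    rewrite -(pulled i).
    have xt : x <= tbar by apply: le_trans xet; rewrite lerDr.
    exact: (prob_few_clean P k Y D Z sched adv eps tbar F _ _ x hmodel eps0 eps4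
      x0 xt tbar1 (mineq i j) (pineq i j)).
  rewrite card_prod card_ord card_option card_bool le_eqVlt; apply/orP; left.
  by apply/eqP; rewrite natrM; field; rewrite pnatr_eq0 gtn_eqF.
pose q i := m1 (F i) - B * m2 (F i) * t.
have mq i : measurable (`[q i, +oo[%classic : set (measurableTypeR R)).
  exact: measurable_itv.
pose W i := Ihat @^-1` [set i] `&` Yout @^-1` `[q i, +oo[.
have mYout A : measurable A -> measurable (Yout @^-1` A).
  by move=> mA; rewrite -[X in measurable X]setTI; exact: measurable_funP.
have mW i : measurable (W i) by apply: measurableI => //; exact: mYout.
(* Total probability over the value of [Ihat]: given arm [i], [Yout] has law [F i] and lies above
   [q i] with probability at least [1/2 + t], by the median shift with [u = t]. *)
have pW : 2^-1 + t <= prob P (\bigcup_i W i).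
  have setTE : [set: 'I_k] = [set` xpredT] by apply/seteqP.
  have pIhat : \sum_(i : 'I_k) prob P (Ihat @^-1` [set i]) = 1.
    rewrite -[RHS](probT P).
    rewrite -(prob_disjoint_sum P _ xpredT (fun i => Ihat @^-1` [set i]))//.
      by congr prob; apply/seteqP; split => // w _; exists (Ihat w).
    move=> i j ij; apply/seteqP; split => w // [/= iw jw].
    by move/eqP: ij; rewrite -iw -jw.
  rewrite setTE prob_disjoint_sum//; last first.
    move=> i j ij; apply/seteqP; split => w // [[/= iw _] [/= jw _]].
    by move/eqP: ij; rewrite -iw -jw.
  rewrite -[leLHS]mul1r -[X in X * _]pIhat mulr_suml; apply: ler_sum => i _.
  have -> : prob P (W i) = prob P (Ihat @^-1` [set i]) * prob (F i) `[q i, +oo[.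
    by apply: EFin_inj; rewrite EFinM -!probE//; exact: hYout.
  rewrite ler_wpM2l ?prob_ge0// prob_rayc.
  have := prob_lt_median_shift _ _ _ _ _ t hB tbar1 (hF i).
  by rewrite t0 tt => /(_ isT); rewrite /q; lra.
set target := [set w | _].
have mtarget : measurable target.
  pose lower i w := emp_median (samples Y D Z sched i w)
    - t * B * emp_mad (samples Y D Z sched i w)
    - ((2^-1 + 2 * kappa * t * B) * alpha + (1 + (1 + 2 * kappa) * B * t) * U).
  have mlower i : measurable_fun setT (lower i).
    have mobs s : measurable_fun setT (observed Y D Z i s).
      exact: measurable_observed.
    apply: measurable_funB => //; apply: measurable_funB.
      exact: (measurable_emp_median _ (pull_times k sched i) mobs).
    apply: measurable_funM => //.
    exact: (measurable_emp_mad _ (pull_times k sched i) mobs).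
  (* Splitting on the finitely many values of [Ihat] replaces the random arm by a fixed one, whose
     estimates are measurable. *)
  have -> : target =
      \bigcup_i (Ihat @^-1` [set i] `&` [set w | lower i w <= Yout w]).
    apply/seteqP; split => w; first by move=> ?; exists (Ihat w).
    by case=> i _ [/= <-].
  apply: fin_bigcup_measurable; first exact: finite_finset.
  by move=> i _; apply: measurableI => //; exact: measurable_le_fun.
(* Outside the failures, the empirical lower estimate of the selected arm is at most [q i], so
   [Yout >= q i] forces the target event. *)
have sub : \bigcup_i W i `<=` target `|` \bigcup_ij Bad ij.
  move=> w [i _] [/= iw]; rewrite in_itv/= andbT => qY.
  have [Badw|Goodw] := pselect ((\bigcup_ij Bad ij) w); [by right|left].
  have good j := many_clean_count P k Y D Z sched (ineq i j) i w
    (fun bw => Goodw (ex_intro2 _ _ (i, j) I bw)).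
  apply: le_trans qY; rewrite /m1hat /m2hat iw.
  have med_le := emp_median_le _ _ (good None).
  have med_ge := emp_median_ge _ _ (good (Some true)).
  apply: (lower_estimate_le _ _ _ _ (h i)) => //.
  (* One [h i] comes from the MAD event, the other from recentring at the empirical median. *)
  rewrite (_ : _ - _ = m2 (F i) - h i - h i); last by ring.
  apply: (emp_mad_ge _ (m1 (F i))) (good (Some false)).
  by rewrite ler_norml; lra.
rewrite probE// lee_fin.
have mWU : measurable (\bigcup_i W i).
  by apply: fin_bigcup_measurable => //; exact: finite_finset.
have := le_prob P _ _ mWU (measurableU _ _ mtarget mBadU) sub.
have := probU_le P _ _ mtarget mBadU.
lra.
Qed.
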